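(* Let $F$ be a noncyclic finitely generated free group. Then there exist an infinite set $S$ and an action of $F$ on $S$ such that: (1) the action is highly transitive; and (2) for every finitely generated subgroup $L$ of infinite index in $F$, the restriction of the action to $L$ is locally finite. Furthermore, every action of $F$ on an infinite set with properties (1) and (2) is faithful.
   Context: An action of a group on a set is faithful if its kernel is trivial. It is highly transitive if it is $k$-transitive for every integer $k\ge 1$, i.e. for every $k\geq 1$ and any two $k$-tuples $(s_1,\dots,s_k)$, $(s'_1,\dots,s'_k)$ of pairwise distinct points there is a group element sending $s_j$ to $s'_j$ for all $j=1,\dots,k$. An action is called locally finite if all of its orbits are finite. *)

(* Defs.v *)
From mathcomp Require Import all_boot all_classical.

Set Implicit Arguments.
Unset Strict Implicit.
Unset Printing Implicit Defensive.

Local Open Scope classical_set_scope.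
Local Open Scope group_scope.

Section Groups.
Variable G : groupType.
Implicit Types (A L X : set G).

Definition is_subgroup L : Prop :=
  [/\ L 1,
      forall x y : G, L x -> L y -> L (x * y)
    & forall x : G, L x -> L x^-1].

Definition generated A : set G := smallest is_subgroup A.

Definition finitely_generated L : Prop :=
  exists2 A : set G, finite_set A & L = generated A.

Definition is_cyclic L : Prop := exists g : G, L = generated [set g].

Definition left_coset (x : G) L : set G := [set x * l | l in L].

Definition infinite_index L : Prop :=
  infinite_set [set left_coset x L | x in [set: G]].

(* The letter (x, false) stands for x and the letter (x, true) for x^-1. *)
Definition word_over X (w : seq (G * bool)) : Prop :=
  forall l : G * bool, l \in w -> X l.1.

Definition reduced (w : seq (G * bool)) : bool :=
  sorted (fun l m => ~~ ((l.1 == m.1) && (l.2 != m.2))) w.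

Definition word_value (w : seq (G * bool)) : G :=
  \prod_(l <- w) (if l.2 then l.1^-1 else l.1).

Definition free_basis X : Prop :=
  forall g : G, exists! w : seq (G * bool),
    [/\ word_over X w, reduced w & word_value w = g].

End Groups.

Definition free_group (G : groupType) : Prop := exists X : set G, free_basis X.

Record group_action (G : groupType) (S : Type) := GroupAction {
  act :> G -> S -> S;
  act1 : forall s : S, act 1 s = s;
  actM : forall (g h : G) (s : S), act (g * h) s = act g (act h s)
}.

Section Actions.
Variables (G : groupType) (S : Type) (a : group_action G S).

Definition action_kernel : set G := [set g | forall s : S, a g s = s].

Definition faithful_action : Prop := action_kernel = [set 1].

Definition k_transitive (k : nat) : Prop :=
  forall s s' : 'I_k -> S, injective s -> injective s' ->
    exists g : G, forall j : 'I_k, a g (s j) = s' j.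

Definition highly_transitive : Prop :=
  forall k : nat, (1 <= k)%N -> k_transitive k.

Definition orbit_under (L : set G) (s : S) : set S := [set a g s | g in L].

Definition locally_finite_on (L : set G) : Prop :=
  forall s : S, finite_set (orbit_under L s).

End Actions.

(* Main.v *)
(* Existence.  The Schreier graph of the action is built on [nat] as a limit of finite
   connected actions, each carrying one loose edge; passing to the next action may
   redirect this edge only, so every other edge is final.
   - High transitivity: cutting the loose edge and hanging a tree of positive words on
     it, one finds a word [w] carrying all the points of the finite action to distinct
     leaves of the tree; a further letter may then permute these leaves arbitrarily, and
     its conjugate by [w] realizes any permutation of the points.
   - Local finiteness: a finitely generated subgroup [L] of infinite index fixes a point
     of a finite action on a set [T] such that the generators of [L], read from that
     point, never cross some edge. Cutting this edge embeds [T] in a set [W] where some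
     word takes [T] off itself. The loose edge is spliced into a finite set of maps
     [T -> W]; paths read by elements of [L] only visit maps meeting the embedding of
     [T], so they miss its translate by that word, where the next loose edge is placed.
     Hence the [L]-orbits of all earlier points are finite and final.

   Faithfulness.  A shortest nontrivial word acting trivially is cyclically reduced, so
   it labels a cycle, which extends to a finite action of [F]. The loops avoiding one
   edge of the cycle form a finitely generated subgroup [L], of infinite index because
   the signed crossings of the edge can be counted. On the given set, however, crossing
   this edge amounts to reading the rest of the cycle backwards, so that finitely many
   translates of an [L]-orbit cover the orbit of [F]. Local finiteness of [L] then makes
   the whole set finite. *)

From mathcomp Require Import all_boot perm action primitive_action alt.
From mathcomp Require Import all_classical ssralg ssrint zify.
Require Import Defs.

Set Implicit Arguments.
Unset Strict Implicit.
Unset Printing Implicit Defensive.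

Local Notation letter K := (K * bool)%type.
Local Notation word K := (seq (letter K)).

(** * Letters acting on a set *)

Section Words.
Variable K : Type.
Implicit Types (l : letter K) (w : word K) (p : seq K).

Definition linv l := (l.1, ~~ l.2).
Definition winv w := rev (map linv w).
Definition positive p : word K := [seq (y, false) | y <- p].

Lemma linvK : involutive linv.
Proof. by case=> x e; rewrite /linv negbK. Qed.

Lemma winv_cons l w : winv (l :: w) = rcons (winv w) (linv l).
Proof. by rewrite /winv /= rev_cons. Qed.

End Words.

Record letter_action (K T : Type) := LetterAction {
  lact :> letter K -> T -> T;
  lactK : forall l, cancel (lact l) (lact (linv l))
}.

Section LetterActions.
Variables (K T : Type) (m : letter_action K T).
Implicit Types (l : letter K) (w : word K) (e : T * letter K) (v : T).

Lemma lactKV l : cancel (m (linv l)) (m l).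
Proof. by move=> v; rewrite -{1}[l]linvK lactK. Qed.

Lemma lact_inj l : injective (m l).
Proof. exact: can_inj (lactK m l). Qed.

Definition wact w v := foldr m v w.

Definition connected := forall u v, exists w, wact w u = v.

(* An edge is given by its source and its letter; it may be crossed backwards. *)
Definition crosses e l v := (v, l) = e \/ (m l v, linv l) = e.

Fixpoint avoids e w v : Prop :=
  if w is l :: w' then avoids e w' v /\ ~ crosses e l (wact w' v) else True.

Lemma wact_cat w1 w2 v : wact (w1 ++ w2) v = wact w1 (wact w2 v).
Proof. exact: foldr_cat. Qed.

Lemma wactK w : cancel (wact w) (wact (winv w)).
Proof.
by elim: w => //= l w IH v; rewrite winv_cons -cats1 wact_cat /= lactK.
Qed.

Lemma avoids_cat e w1 w2 v :
  avoids e (w1 ++ w2) v <-> avoids e w2 v /\ avoids e w1 (wact w2 v).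
Proof.
elim: w1 => [|l w1 IH] /=; first by split=> [|[]].
by rewrite wact_cat IH; tauto.
Qed.

Lemma connected_of_root u : (forall v, exists w, wact w u = v) -> connected.
Proof.
move=> reach v v'; have [w <-] := reach v; have [w' <-] := reach v'.
by exists (w' ++ winv w); rewrite wact_cat wactK.
Qed.

Lemma crosses_linv e l v : crosses e (linv l) (m l v) <-> crosses e l v.
Proof. by rewrite /crosses lactK linvK; tauto. Qed.

Lemma avoids_winv e w v : avoids e w v -> avoids e (winv w) (wact w v).
Proof.
elim: w => //= l w IH [w_off l_off]; rewrite winv_cons -cats1; apply/avoids_cat.
by split=> /=; [rewrite crosses_linv|rewrite lactK; apply: IH].
Qed.

Lemma crosses_positive t z y v :
  crosses (t, (z, false)) (y, false) v <-> (v, y) = (t, z).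
Proof. by split=> [[[-> ->]|[]]|[-> ->]]; last left. Qed.

Lemma avoids_positive t z p v :
    (forall p1 y p2, p = p1 ++ y :: p2 -> (wact (positive p2) v, y) <> (t, z)) ->
  avoids (t, (z, false)) (positive p) v.
Proof.
elim: p => //= y p IH off; split; last by rewrite crosses_positive; apply: (off [::]).
by apply: IH => p1 x p2 pE; apply: (off (y :: p1)); rewrite pE.
Qed.

End LetterActions.

Arguments lact_inj {K T} m l [x1 x2].

Section Maps.
Variables (K T T' : Type) (m : letter_action K T) (m' : letter_action K T').
Variable j : T -> T'.
Implicit Types (l : letter K) (w : word K) (e : T * letter K).

Definition equivariant := forall l v, j (m l v) = m' l (j v).

Definition agrees_off e := forall l v, ~ crosses m e l v -> j (m l v) = m' l (j v).

Lemma equivariant_wact w v : equivariant -> j (wact m w v) = wact m' w (j v).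
Proof. by move=> j_equiv; elim: w => //= l w <-. Qed.

Lemma agrees_off_wact e w v :
  agrees_off e -> avoids m e w v -> j (wact m w v) = wact m' w (j v).
Proof. by move=> j_agrees; elim: w => //= l w IH [/IH <- /j_agrees]. Qed.

Lemma equivariant_avoids t l w v : equivariant -> injective j ->
  avoids m (t, l) w v -> avoids m' (j t, l) w (j v).
Proof.
move=> j_equiv j_inj; elim: w => //= l' w IH [/IH w_off l_off]; split=> //.
rewrite -equivariant_wact // /crosses -j_equiv.
by move=> [] [/j_inj vt l'E]; apply: l_off; [left|right]; rewrite vt l'E.
Qed.

Lemma equivariant_positive :
  (forall y v, j (m (y, false) v) = m' (y, false) (j v)) -> equivariant.
Proof.
move=> j_equiv [y []] v //; have {2}-> : v = m (y, false) (m (y, true) v).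
  by rewrite (lactK m (y, true)).
by rewrite j_equiv (lactK m' (y, false)).
Qed.

Lemma agrees_off_positive t z :
    (forall y v, (v, y) <> (t, z) -> j (m (y, false) v) = m' (y, false) (j v)) ->
  agrees_off (t, (z, false)).
Proof.
move=> j_agrees [y []] v; last by rewrite crosses_positive; apply: j_agrees.
have -> : v = m (y, false) (m (y, true) v) by rewrite (lactK m (y, true)).
rewrite -[(y, true)]/(linv (y, false)) crosses_linv crosses_positive lactK.
by move=> /j_agrees ->; rewrite lactK.
Qed.

Lemma agrees_off_target t z t' z' :
    agrees_off (t, (z, false)) -> z' <> z -> (forall v, j v <> t') ->
  forall v, j v <> m' (z', false) t'.
Proof.
move=> j_agrees z'z t'N v vE; case: (t'N (m (z', true) v)).
rewrite j_agrees ?vE; first exact: (lactK m' (z', false)).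
by case=> -[] // _ /z'z.
Qed.

End Maps.

Lemma transport_action (K T T' : Type) (m : letter_action K T) (phi : T -> T') :
  bijective phi ->
  exists m' : letter_action K T', equivariant m m' phi.
Proof.
move=> [psi phiK psiK]; pose act l v := phi (m l (psi v)).
have actK l : cancel (act l) (act (linv l)).
  by move=> v; rewrite /act phiK lactK psiK.
by exists (LetterAction actK) => l v; rewrite /= /act phiK.
Qed.

Lemma connected_component_action (K : Type) (T : finType) (m : letter_action K T)
    (x : T) :
  exists (C : finType) (mC : letter_action K C) (j : C -> T),
  [/\ injective j, equivariant mC m j, connected mC & exists c, j c = x].
Proof.
pose P v := `[< exists w, wact m w x = v >].
have Pm l v : P v -> P (m l v).
  by move=> /asboolP[w <-]; apply/asboolP; exists (l :: w).
have Px : P x by apply/asboolP; exists [::].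
pose act l (c : {v | P v}) : {v | P v} := exist _ (m l (val c)) (Pm l _ (valP c)).
have actK l : cancel (act l) (act (linv l)).
  by move=> c; apply: val_inj; rewrite /= lactK.
pose mC := LetterAction actK.
exists {v | P v}, mC, val; split=> //.
- apply: (@connected_of_root _ _ _ (exist _ x Px)) => v; have /asboolP[w wE] := valP v.
  by exists w; apply: val_inj; rewrite (equivariant_wact (m' := m)).
- by exists (exist _ x Px).
Qed.

Section PartialBijections.

Definition partial_bijection (T T' : Type) (R : T -> T' -> Prop) :=
  forall u u' v v', R u v -> R u' v' -> (u = u' <-> v = v').

Definition bijective_pairs (T : eqType) (ps : seq (T * T)) :=
  partial_bijection (fun u v => (u, v) \in ps).

Lemma partial_bijection_extends (T : finType) (R : T -> T -> Prop) :
  partial_bijection R -> exists s : {perm T}, forall u v, R u v -> s u = v.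
Proof.
move=> R_bij; pose D : {set T} := [set u | `[< exists v, R u v >]].
have /choice[f Rf] u : exists v, u \in D -> R u v.
  by have [|] := boolP (u \in D); [rewrite inE => /asboolP[v]; exists v|exists u].
have D_k : #|D| <= #|T| by apply: max_card.
have /atransP2 sym_trans := ntransitive_weak D_k (Sym_trans T).
have [||s _ /(congr1 val) /= sE] :=
    sym_trans (enum_tuple D) (map_tuple f (enum_tuple D)).
- by rewrite inE enum_uniq; apply/fintype.subsetP.
- rewrite inE /= map_inj_in_uniq ?enum_uniq; first exact/fintype.subsetP.
  by move=> u v; rewrite !mem_enum => /Rf uf /Rf vf /(R_bij _ _ _ _ uf vf).
exists s => u v Ruv; have uD : u \in D by rewrite inE; apply/asboolP; exists v.
have -> : s u = f u by move/eq_in_map: sE => /(_ u) -> //; rewrite mem_enum.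
by have [/(_ erefl)] := R_bij _ _ _ _ (Rf u uD) Ruv.
Qed.

Lemma letter_action_completion (K : Type) (T : finType) (R : K -> T -> T -> Prop) :
    (forall y, partial_bijection (R y)) ->
  exists m : letter_action K T, forall y u v, R y u v -> m (y, false) u = v.
Proof.
move=> R_bij; have /choice[s sR] y := partial_bijection_extends (R_bij y).
pose act (l : letter K) := if l.2 then (s l.1)^-1%g : {perm T} else s l.1.
have actK l : cancel (act l) (act (linv l)).
  by case: l => y [] v /=; rewrite ?permKV ?permK.
by exists (LetterAction actK) => y u v /sR.
Qed.

Lemma positive_letter_action (K : Type) (T : finType) (f : K -> T -> T) :
    (forall y, injective (f y)) ->
  exists m : letter_action K T, forall y u, m (y, false) u = f y u.
Proof.
move=> f_inj; have [y|m mR] := @letter_action_completion K T (fun y u v => f y u = v).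
  by move=> u u' _ _ <- <-; split=> [->|/f_inj].
by exists m => y u; apply: mR.
Qed.

Lemma ord_embedding_extends n (W : finType) (j : 'I_n -> W) : injective j ->
  exists2 phi : W -> 'I_#|W|, bijective phi & forall i, val (phi (j i)) = val i.
Proof.
move=> j_inj; have nW : n <= #|W| by rewrite -[n]card_ord (leq_card j).
pose R u v := exists i, u = enum_rank (j i) /\ v = widen_ord nW i.
have [|s sR] := @partial_bijection_extends _ R.
  move=> _ _ _ _ [i [-> ->]] [i' [-> ->]]; split=> [/enum_rank_inj/j_inj->//|].
  by move=> /(congr1 val) /= /ord_inj ->.
exists (s \o enum_rank) => [|i]; last first.
  by rewrite /= (sR _ (widen_ord nW i)) //; exists i.
by apply: bij_comp; [exists s^-1%g; [exact: permK|exact: permKV]|exact: enum_rank_bij].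
Qed.

End PartialBijections.

Section FiniteActions.
Variables (K : Type) (T : finType) (m : letter_action K T).

Lemma inverse_letter_iter y u :
  exists k, m (y, true) u = wact m (positive (nseq k y)) u.
Proof.
exists (fingraph.order (m (y, false)) u).-1; apply: (lact_inj m (y, false)).
rewrite [LHS](lactK m (y, true)) -{1}[u](f_finv (lact_inj m (y, false))).
by rewrite /finv; congr (m _ _); elim: _.-1 => //= k ->.
Qed.

Lemma positive_path w u : exists p, wact m (positive p) u = wact m w u.
Proof.
elim: w => [|[y []] w [p pE]] /=; first by exists [::].
  have [k kE] := inverse_letter_iter y (wact m w u); exists (nseq k y ++ p).
  by rewrite /positive map_cat wact_cat -/(positive p) pE kE.
by exists (y :: p); rewrite /= pE.
Qed.

Lemma positive_path_avoiding t z u : connected m ->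
  exists2 p, wact m (positive p) u = t & avoids m (t, (z, false)) (positive p) u.
Proof.
move=> m_conn; have [w] := m_conn u t; have [p <-] := positive_path w u.
elim/last_ind: p u => [|p y IH] u; first by exists [::].
case: (pselect (u = t)) => [ut _|ut]; first by exists [::].
rewrite /positive map_rcons -cats1 wact_cat => /IH[q qE q_off].
exists (rcons q y); rewrite /positive map_rcons -cats1 ?wact_cat //.
by apply/avoids_cat; split=> //=; split=> // /crosses_positive[/ut].
Qed.

Lemma connected_off_edge t z u v : connected m ->
  exists2 w, wact m w u = v & avoids m (t, (z, false)) w u.
Proof.
move=> m_conn.
have [p pE p_off] := positive_path_avoiding t z u m_conn.
have [q qE q_off] := positive_path_avoiding t z v m_conn.
exists (winv (positive q) ++ positive p); first by rewrite wact_cat pE -qE wactK.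
by apply/avoids_cat; split=> //; rewrite pE -{2}qE; apply: avoids_winv.
Qed.

End FiniteActions.

(** * Escaping through one edge *)

Section Suffixes.
Variable A : eqType.
Implicit Types s : seq A.

Definition suffixes s := [seq drop i s | i <- iota 0 (size s).+1].

Lemma mem_suffixes s' s : (s' \in suffixes s) = suffix s' s.
Proof.
apply/mapP/suffixP => [[i _ ->]|[s1 ->]].
  by exists (take i s); rewrite cat_take_drop.
exists (size s1); last by rewrite drop_size_cat.
by rewrite mem_iota size_cat /=; lia.
Qed.

Lemma no_shifted_block (a z : A) M s s' q : a != z -> size s' <= M ->
  a :: nseq M z ++ s' = q ++ a :: nseq M z ++ s -> q = [::].
Proof.
case: q => // y q az s'M words_eq.
have := congr1 size words_eq; have := congr1 (nth a ^~ (size q).+1) words_eq.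
rewrite /= !size_cat /= !size_cat !size_nseq !nth_cat ltnn subnn /= => nthE sizeE.
have qM : size q < M by lia.
by move: nthE az; rewrite size_nseq qM nth_nseq qM => ->; rewrite eqxx.
Qed.

End Suffixes.

Lemma connected_of_reach (K : Type) (T : finType) (m : letter_action K T) t z
    (T' : Type) (m' : letter_action K T') (j : T -> T') :
    connected m -> agrees_off m m' j (t, (z, false)) ->
    (forall c, exists v w, wact m' w (j v) = c) ->
  connected m'.
Proof.
move=> m_conn j_agrees reach c d.
have [v [w <-]] := reach c; have [v' [w' <-]] := reach d.
have [q <- q_off] := connected_off_edge t z v v' m_conn.
by exists (w' ++ q ++ winv w); rewrite !wact_cat wactK (agrees_off_wact j_agrees).
Qed.

Section Escape.
Variables (K : choiceType) (T : finType) (m : letter_action K T) (t : T) (z a : K).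
Hypotheses (m_conn : connected m) (az : a != z).

(* The edge [z] leaving [t] is redirected to the root [inr [::]] of the tree of
   positive words, the letter read last being the head of the word. *)
Definition escape_step y (c : T + seq K) : T + seq K :=
  match c with
  | inl v => if (v, y) == (t, z) then inr [::] else inl (m (y, false) v)
  | inr u => inr (y :: u)
  end.

Definition escape_run p c := foldr escape_step c p.

Lemma escape_step_inj y : injective (escape_step y).
Proof.
case=> [v|u] [v'|u'] //=; last by case=> ->.
- case: eqP => [[vt _]|_]; case: eqP => [[v't _]|_] //; first by rewrite vt v't.
  by move=> [vv']; rewrite (lact_inj _ _ vv').
- by case: ifP.
- by case: ifP.
Qed.

Lemma escape_run_inj p : injective (escape_run p).
Proof. by elim: p => //= y p IH c c' /escape_step_inj /IH. Qed.

Lemma escape_run_cat p q c : escape_run (p ++ q) c = escape_run p (escape_run q c).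
Proof. exact: foldr_cat. Qed.

Lemma escape_run_tree p u : escape_run p (inr u) = inr (p ++ u).
Proof. by elim: p => //= y p ->. Qed.

Lemma escape_run_size p v s : escape_run p (inl v) = inr s -> size s <= size p.
Proof.
elim: p s => //= y p IH s; case: escape_run IH => [v' _|u IH] /=.
  by case: ifP => // _ [<-].
by case=> <- /=; rewrite ltnS IH.
Qed.

Lemma escape_run_avoids p v : avoids m (t, (z, false)) (positive p) v ->
  escape_run p (inl v) = inl (wact m (positive p) v).
Proof.
by elim: p => //= y p IH [/IH-> /crosses_positive/eqP vt]; rewrite /= ifN.
Qed.

Lemma exists_common_escape : exists p, forall v, exists s, escape_run p (inl v) = inr s.
Proof.
suff [p p_escapes] : exists p, forall v, v \in enum T ->
    exists s, escape_run p (inl v) = inr s.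
  by exists p => v; apply: p_escapes; rewrite mem_enum.
elim: (enum T) => [|v A [p p_escapes]]; first by exists [::].
have [q [s qE]] : exists q s, escape_run (q ++ p) (inl v) = inr s.
  case pv: (escape_run p (inl v)) => [v'|s]; last by exists [::], s.
  have [q qE q_off] := positive_path_avoiding t z v' m_conn.
  exists (z :: q), [::].
  by rewrite /= escape_run_cat pv escape_run_avoids // qE /= eqxx.
exists (q ++ p) => u; rewrite inE => /predU1P[->|]; first by exists s.
move=> /p_escapes[s' s'E].
by exists (q ++ s'); rewrite escape_run_cat s'E escape_run_tree.
Qed.

(* Appending a long block of [z]'s closed by [a] makes the end points of the common
   escape pairwise incomparable for the suffix order. *)
Lemma exists_common_leaves : exists p (U : T -> seq K),
  [/\ forall v, escape_run p (inl v) = inr (U v),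
      forall v v' y q, suffix q p -> escape_run q (inl v) <> inr (y :: U v')
    & forall v, exists u, U v = a :: u].
Proof.
have [p /choice[s sE]] := exists_common_escape.
pose block u := a :: nseq (size p) z ++ u.
have blockE v : escape_run (block p) (inl v) = inr (block (s v)).
  by rewrite /= escape_run_cat sE escape_run_tree.
exists (block p), (block \o s); split=> // [v v' y q /suffixP[q' pE] qE|v]; last first.
  by exists (nseq (size p) z ++ s v).
have := blockE v; rewrite pE escape_run_cat qE escape_run_tree => -[].
rewrite -cat_rcons => /esym/no_shifted_block.
by move=> /(_ az (escape_run_size (sE v))); case: (q').
Qed.

Section Leaves.
Variables (p : seq K) (U : T -> seq K) (sigma : {perm T}).
Hypothesis U_run : forall v, escape_run p (inl v) = inr (U v).
Hypothesis U_last :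
  forall v v' y q, suffix q p -> escape_run q (inl v) <> inr (y :: U v').
Hypothesis U_head : forall v, exists u, U v = a :: u.

Definition visited := [seq escape_run q (inl v) | v <- enum T, q <- suffixes p].

Lemma mem_visited q v : suffix q p -> escape_run q (inl v) \in visited.
Proof.
by move=> qp; apply/allpairsP; exists (v, q); rewrite mem_enum mem_suffixes.
Qed.

Lemma visitedP c : c \in visited -> exists v q, suffix q p /\ c = escape_run q (inl v).
Proof.
by move=> /allpairsP[[v q] [_]]; rewrite mem_suffixes => qp ->; exists v, q.
Qed.

Lemma leaf_inj : injective U.
Proof.
by move=> v v' Uvv'; apply/inl_inj/(@escape_run_inj p); rewrite !U_run Uvv'.
Qed.

Lemma leaf_not_z c v : escape_step z c <> inr (U v).
Proof.
have [u ->] := U_head v; case: c => [v'|u'] /=; first by case: ifP.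
by case=> za; move: az; rewrite za eqxx.
Qed.

Lemma leaf_has_no_successor c y v : c \in visited -> c <> escape_step y (inr (U v)).
Proof. by move=> /visitedP[v' [q [qp ->]]]; apply: U_last. Qed.

Lemma leaf_permuting_action : exists m' : letter_action K (seq_sub visited),
  (forall y c d, val d = escape_step y (val c) -> m' (y, false) c = d) /\
  (forall c d v, val c = inr (U v) -> val d = inr (U (sigma v)) ->
    m' (z, false) c = d).
Proof.
pose R y (c d : seq_sub visited) := val d = escape_step y (val c) \/
  y = z /\ exists2 v, val c = inr (U v) & val d = inr (U (sigma v)).
have mixed (c d c' d' : seq_sub visited) v :
    val d = escape_step z (val c) -> val c' = inr (U v) ->
    val d' = inr (U (sigma v)) -> c <> c' /\ d <> d'.
  move=> dE c'E d'E; split=> [cc'|dd'].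
    apply: (leaf_has_no_successor (ssvalP d) (y := z) (v := v)).
    by rewrite -c'E -cc'.
  by apply: (@leaf_not_z (val c) (sigma v)); rewrite -dE dd'.
have [y|m' m'R] := @letter_action_completion _ _ R; last first.
  exists m'; split=> [y c d dE|c d v cE dE]; apply: m'R; first by left.
  by right; split=> //; exists v.
move=> c c' d d' [dE|[yz [v cE dE]]] [d'E|[yz' [v' c'E d'E]]].
- split=> [cc'|dd']; apply: val_inj; first by rewrite dE d'E cc'.
  by apply: (@escape_step_inj y); rewrite -dE -d'E dd'.
- rewrite yz' in dE; have [cc' dd'] := mixed _ _ _ _ _ dE c'E d'E.
  by split=> [/cc'|/dd'].
- rewrite yz in d'E; have [cc' dd'] := mixed _ _ _ _ _ d'E cE dE.
  by split=> /esym => [/cc'|/dd'].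
- split=> [cc'|dd']; apply: val_inj.
    by rewrite dE d'E; move: cE; rewrite cc' c'E => -[/leaf_inj ->].
  by rewrite cE c'E; move: dE; rewrite dd' d'E => -[/leaf_inj/perm_inj ->].
Qed.

End Leaves.

Lemma escape_permuting (sigma : {perm T}) :
  exists (W : finType) (m' : letter_action K W) (j : T -> W) (p : seq K),
    [/\ injective j, agrees_off m m' j (t, (z, false)), connected m',
        forall v, m' (z, false) (wact m' (positive p) (j v)) =
                  wact m' (positive p) (j (sigma v))
      & forall v v', wact m' (positive p) (j v) <> j v' /\
          forall y,
            avoids m' (wact m' (positive p) (j v), (y, false)) (positive p) (j v')].
Proof.
have [p [U [U_run U_last U_head]]] := exists_common_leaves.
have [m' [m'_step m'_leaf]] := leaf_permuting_action sigma U_run U_last U_head.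
pose j v : seq_sub (visited p) := SeqSub (mem_visited v (suffix0s p)).
have run q v : suffix q p -> val (wact m' (positive q) (j v)) = escape_run q (inl v).
  elim: q => //= y q IH yqp.
  rewrite (m'_step _ _ (SeqSub (mem_visited v yqp))) //= IH //.
  exact: (catl_suffix (s := [:: y]) yqp).
have run_p v : val (wact m' (positive p) (j v)) = inr (U v).
  by rewrite run ?suffix_refl ?U_run.
have leaf_new v v' y q : suffix (y :: q) p ->
    wact m' (positive q) (j v) <> wact m' (positive p) (j v').
  move=> yqp /(congr1 val); rewrite run_p run ?(catl_suffix (s := [:: y]) yqp) // => qE.
  by apply: (U_last v v' y _ yqp); rewrite /= qE.
have j_off : agrees_off m m' j (t, (z, false)).
  by apply: agrees_off_positive => y v /eqP vt; apply/esym/m'_step; rewrite /= ifN.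
exists (seq_sub (visited p)), m', j, p; split=> //.
- by move=> v v' /(congr1 val) [].
- apply: connected_of_reach m_conn j_off _ => c.
  have [v [q [qp cE]]] := visitedP (ssvalP c).
  by exists v, (positive q); apply: val_inj; rewrite run.
- by move=> v; apply: m'_leaf; rewrite run_p.
- move=> v v'; split=> [/(congr1 val)|y]; first by rewrite run_p.
  apply: avoids_positive => p1 x p2 pE [/leaf_new qN _]; apply: (qN x).
  by apply/suffixP; exists p1.
Qed.

End Escape.

(** * Stages and their extensions *)

Section OrdinalActions.
Variables (K : Type) (n : nat) (m : letter_action K 'I_n).

Definition nat_act l v := if insub v is Some i then val (m l i) else v.

Lemma nat_act_ord l (i : 'I_n) : nat_act l (val i) = val (m l i).
Proof. by rewrite /nat_act valK. Qed.

Lemma nat_actK l : cancel (nat_act l) (nat_act (linv l)).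
Proof.
move=> v; rewrite {2}/nat_act; case: insubP => [i _ <-|vn]; last first.
  by rewrite /nat_act insubN.
by rewrite nat_act_ord lactK.
Qed.

Definition nat_action := LetterAction nat_actK.

End OrdinalActions.

Section Stages.
Variable K : choiceType.

(* Only the loose edge may be changed at later stages. *)
Record stage := Stage {
  bound : nat;
  sact : letter_action K 'I_bound;
  loose_source : 'I_bound;
  loose_letter : K;
  sact_connected : connected sact
}.

Implicit Types (G H : stage) (w g : word K).

Definition loose_edge G := (loose_source G, (loose_letter G, false)).

Definition extends G H :=
  [/\ agrees_off (sact G) (nat_action (sact H)) val (loose_edge G),
      bound G <= loose_source H
    & bound G <= sact H (loose_letter H, false) (loose_source H)].

Definition carries H g (u v : nat) := exists i : 'I_(bound H),
  [/\ val i = u, avoids (sact H) (loose_edge H) g i & val (wact (sact H) g i) = v].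

Definition encloses H (ws : seq (word K)) (u : nat) :=
  exists2 C : set 'I_(bound H), (exists2 i, C i & val i = u)
    & forall w i, w \in ws -> C i ->
        avoids (sact H) (loose_edge H) w i /\ C (wact (sact H) w i).

Lemma extends_bound G H : extends G H -> bound G < bound H.
Proof. by case=> _ srcH _; apply: leq_ltn_trans srcH _. Qed.

Lemma extends_crosses G H l (i : 'I_(bound H)) :
  extends G H -> i < bound G -> ~ crosses (sact H) (loose_edge H) l i.
Proof.
move=> [_ src tgt] iG [[iE _]|]; first by move: src; rewrite -iE leqNgt iG.
case=> [liE lE l2]; have lvE : (loose_letter H, false) = linv l by rewrite -lE -l2.
by move: tgt; rewrite lvE -liE lactK leqNgt iG.
Qed.

Lemma extends_trans G H I : extends G H -> extends H I -> extends G I.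
Proof.
move=> GH HI; have [agreeGH _ _] := GH; have [agreeHI srcI tgtI] := HI.
have leGH := ltnW (extends_bound GH).
split; [|exact: leq_trans srcI|exact: leq_trans tgtI] => l i /agreeGH ->.
rewrite -[val i]/(val (widen_ord leGH i)) [LHS]nat_act_ord.
by rewrite agreeHI //; apply: (extends_crosses GH); exact: (ltn_ord i).
Qed.

Lemma stage_extension G (W : finType) (m : letter_action K W) j t z :
    connected m -> injective j -> agrees_off (sact G) m j (loose_edge G) ->
    z <> loose_letter G -> (forall i, j i <> t) ->
  exists H (phi : W -> 'I_(bound H)),
    [/\ extends G H, equivariant m (sact H) phi, injective phi,
        loose_edge H = (phi t, (z, false)) & forall i, val (phi (j i)) = val i].
Proof.
move=> m_conn j_inj j_agrees zG tN.
have [phi phi_bij phi_j] := ord_embedding_extends j_inj.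
have [m' phi_m] := transport_action m phi_bij; have phi_inj := bij_inj phi_bij.
have m'_conn : connected m'.
  have [psi phiK psiK] := phi_bij => u v; have [w wE] := m_conn (psi u) (psi v).
  by exists w; rewrite -[u]psiK -(equivariant_wact w _ phi_m) wE psiK.
have phi_ge c : (forall i, j i <> c) -> bound G <= phi c.
  move=> cN; rewrite leqNgt; apply/negP => phi_lt; case: (cN (Ordinal phi_lt)).
  by apply/phi_inj/val_inj; rewrite phi_j.
exists (Stage (phi t) z m'_conn), phi; split=> //; split=> /= [l i off||].
- by rewrite -phi_j (j_agrees _ _ off) phi_m -nat_act_ord phi_j.
- exact: phi_ge.
- by rewrite -phi_m; apply: phi_ge => i; apply: (agrees_off_target (z' := z) j_agrees).
Qed.

Hypothesis two_letters : exists x y : K, x != y.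

Lemma other_letter z : exists a : K, a != z.
Proof.
have [x [y xy]] := two_letters; have [->|zx] := eqVneq z x.
  by exists y; rewrite eq_sym.
by exists x; rewrite eq_sym.
Qed.

Lemma extension_permuting G (sigma : {perm 'I_(bound G)}) :
  exists2 H, extends G H & exists g, forall i, carries H g (val i) (val (sigma i)).
Proof.
have [a az] := other_letter (loose_letter G).
have [W [m [j [p [j_inj j_agrees m_conn p_sigma p_off]]]]] :=
  escape_permuting (loose_source G) (@sact_connected G) az sigma.
pose t := wact m (positive p) (j (loose_source G)).
have tN i : j i <> t.
  by have [pN _] := p_off (loose_source G) i => /esym/pN.
have aG : a <> loose_letter G by apply/eqP.
have [H [phi [GH phi_m phi_inj looseH phi_j]]] :=
  stage_extension m_conn j_inj j_agrees aG tN.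
exists H => //.
exists (winv (positive p) ++ (loose_letter G, false) :: positive p) => i.
exists (phi (j i)); rewrite -(equivariant_wact _ _ phi_m) phi_j; split=> //; last first.
  by rewrite wact_cat /= p_sigma wactK phi_j.
rewrite looseH; apply: equivariant_avoids => //; apply/avoids_cat; split.
  split; first by have [_ /(_ a)] := p_off (loose_source G) i.
  by rewrite crosses_positive => -[_ /esym].
rewrite /= p_sigma; apply: avoids_winv.
by have [_ /(_ a)] := p_off (loose_source G) (sigma i).
Qed.

Lemma extension_exists G : exists H, extends G H.
Proof.
by have [H GH _] := extension_permuting (1%g : {perm 'I_(bound G)}); exists H.
Qed.

Lemma extension_large G N : exists2 H, extends G H & N <= bound H.
Proof.
elim: N => [|N [H GH NH]]; first by have [H GH] := extension_exists G; exists H.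
have [I HI] := extension_exists H; exists I; first exact: extends_trans HI.
exact: leq_ltn_trans (extends_bound HI).
Qed.

Lemma extension_carrying G (ps : seq (nat * nat)) :
    bijective_pairs ps ->
  exists2 H, extends G H & exists g, forall u v, (u, v) \in ps -> carries H g u v.
Proof.
move=> ps_bij; have [H GH psH] := extension_large G (\max_(q <- ps) maxn q.1 q.2).+1.
have [|sigma sigmaP] := @partial_bijection_extends 'I_(bound H)
    (fun u v => (val u, val v) \in ps).
  move=> u u' v v' uv /(ps_bij _ _ _ _ uv)[fst_snd snd_fst].
  by split=> /(congr1 val) => [/fst_snd|/snd_fst] /val_inj.
have [I HI [g gI]] := extension_permuting sigma.
exists I; first exact: extends_trans HI.
exists g => u v uv.
have lt_uv : maxn u v < bound H.
  apply: leq_trans psH; rewrite ltnS.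
  exact: (leq_bigmax_seq (F := fun q => maxn q.1 q.2) _ uv).
have [uH vH] : u < bound H /\ v < bound H by move: lt_uv; rewrite gtn_max => /andP.
by have := gI (Ordinal uH); rewrite (sigmaP _ (Ordinal vH)).
Qed.

End Stages.

(** * Splicing two actions *)

Section Splicing.
Variables (K : eqType) (T1 T2 : finType).
Variables (m1 : letter_action K T1) (m2 : letter_action K T2).
Variables (t1 : T1) (t2 : T2) (z : K).

Lemma splice : exists m : letter_action K (T1 + T2)%type,
  [/\ agrees_off m1 m inl (t1, (z, false)), agrees_off m2 m inr (t2, (z, false)),
      m (z, false) (inl t1) = inr (m2 (z, false) t2)
    & m (z, false) (inr t2) = inl (m1 (z, false) t1)].
Proof.
pose f (l : letter K) c := match c with
  | inl v => inl (m1 l v) | inr v => inr (m2 l v) end : (T1 + T2)%type.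
have f_inj l : injective (f l).
  by move=> [v|v] [v'|v'] //= [vv']; rewrite (lact_inj _ _ vv').
pose tau y := (if y == z then tperm (inl t1) (inr t2) else 1)%g : {perm (T1 + T2)%type}.
have [y|m mE] := @positive_letter_action K _ (fun y c => f (y, false) (tau y c)).
  exact: inj_comp (f_inj _) perm_inj.
have tau_id y c : (c, y) <> (inl t1, z) -> (c, y) <> (inr t2, z) -> tau y c = c.
  rewrite /tau; case: eqP => [->|_] c1 c2; last by rewrite perm1.
  by apply/tpermD; apply/eqP => cE; [apply: c1|apply: c2]; rewrite -cE.
exists m; split.
- apply: agrees_off_positive => y v vy.
  by rewrite mE tau_id // => -[vE yE]; apply: vy; rewrite vE yE.
- apply: agrees_off_positive => y v vy.
  by rewrite mE tau_id // => -[vE yE]; apply: vy; rewrite vE yE.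
- by rewrite mE /tau eqxx tpermL.
- by rewrite mE /tau eqxx tpermR.
Qed.

Lemma splice_connected (m : letter_action K (T1 + T2)%type) :
    connected m1 -> connected m2 ->
    agrees_off m1 m inl (t1, (z, false)) -> agrees_off m2 m inr (t2, (z, false)) ->
    m (z, false) (inl t1) = inr (m2 (z, false) t2) ->
  connected m.
Proof.
move=> m1_conn m2_conn ml mr mz; apply: (@connected_of_root _ _ _ (inl t1)) => -[v|v].
  have [w <- w_off] := connected_off_edge t1 z t1 v m1_conn.
  by exists w; rewrite (agrees_off_wact ml).
have [w <- w_off] := connected_off_edge t2 z (m2 (z, false) t2) v m2_conn.
by exists (w ++ [:: (z, false)]); rewrite wact_cat /= mz (agrees_off_wact mr).
Qed.

End Splicing.

Section Shadows.
Variables (K T Y : Type) (m : letter_action K T) (mY : letter_action K Y).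

Definition shadows e (A : T -> set Y) :=
  forall l d c, ~ crosses m e l d -> A d c -> A (m l d) (mY l c).

Lemma shadows_wact e A w d c : shadows e A -> avoids m e w d -> A d c ->
  A (wact m w d) (wact mY w c).
Proof. by move=> eA + Adc; elim: w => //= l w IH [/IH + nc]; apply: eA. Qed.

Lemma shadows_avoids e A t l w d c : shadows e A -> (forall d, ~ A d t) ->
  avoids m e w d -> A d c -> avoids mY (t, l) w c.
Proof.
move=> eA At + Adc; elim: w => //= l' w IH [w_off nc]; split; first exact: IH.
have Aw := shadows_wact eA w_off Adc.
case=> [[cE _]|[cE _]]; first by apply: (At (wact m w d)); rewrite -cE.
by apply: (At (m l' (wact m w d))); rewrite -cE; apply: eA.
Qed.

End Shadows.

Section Diagonal.
Variables (K : Type) (T W : finType) (m : letter_action K W).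

Lemma diagonal_action : exists mV : letter_action K {ffun T -> W},
  forall l f x, mV l f x = m l (f x).
Proof.
pose act l (f : {ffun T -> W}) := [ffun x => m l (f x)].
have actK l : cancel (act l) (act (linv l)).
  by move=> f; apply/ffunP => x; rewrite !ffunE lactK.
by exists (LetterAction actK) => l f x; rewrite ffunE.
Qed.

Lemma diagonal_component (f0 : T -> W) :
  exists (C : finType) (mC : letter_action K C) (ev : C -> T -> W),
    [/\ connected mC, forall x, equivariant mC m (ev^~ x) & exists c, ev c = f0].
Proof.
have [mV mVE] := diagonal_action.
have [C [mC [j [_ j_mC mC_conn [c cE]]]]] := connected_component_action mV (finfun f0).
exists C, mC, (fun d x => j d x); split=> // [x l d|]; first by rewrite j_mC mVE.
by exists c; apply/funext => x; rewrite cE ffunE.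
Qed.

End Diagonal.

(* Spliced to [T1] is a finite set [C] of functions [T -> W], translates of [j]. When a
   word is read at once from [d : T], avoiding [e], and from a point of [T1 + C], every
   function visited meets [j] at the current point of [T]. *)
Section SplicedFunctions.
Variables (K : eqType) (T T1 C : finType) (W : Type).
Variables (m : letter_action K T) (mW : letter_action K W) (j : T -> W).
Variables (mC : letter_action K C) (ev : C -> T -> W) (c0 : C).
Variables (m1 : letter_action K T1) (mY : letter_action K (T1 + C)%type).
Variables (e : T * letter K) (t1 : T1) (z : K).
Let t2 := mC (z, true) c0.
Hypothesis j_agrees : agrees_off m mW j e.
Hypothesis ev_mC : forall x, equivariant mC mW (ev^~ x).
Hypothesis ev_c0 : ev c0 = j.
Hypothesis mYl : agrees_off m1 mY inl (t1, (z, false)).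
Hypothesis mYr : agrees_off mC mY inr (t2, (z, false)).
Hypothesis mYt1 : mY (z, false) (inl t1) = inr (mC (z, false) t2).
Hypothesis mYt2 : mY (z, false) (inr t2) = inl (m1 (z, false) t1).

Definition meets d (c : T1 + C) := if c is inr f then exists x, ev f x = j d else True.

Lemma splice_shadows : shadows m mY e meets.
Proof.
have mYt1V : mY (z, true) (inl (m1 (z, false) t1)) = inr t2.
  by rewrite -mYt2; apply: (lactK mY (z, false)).
have mYt2V : mY (z, true) (inr (mC (z, false) t2)) = inl t1.
  by rewrite -mYt1; apply: (lactK mY (z, false)).
move=> [y b] d [v|f] off Adc /=.
  have [[[-> yz bE]|[vE yz bE]]|/mYl <- //] :=
      pselect (crosses m1 (t1, (z, false)) (y, b) v).
    move: off; rewrite yz bE mYt1 /t2 (lactKV mC (z, false)) => off.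
    by exists (m (z, false) d); rewrite ev_c0.
  move: off vE; rewrite yz (negbFE bE) => off vE.
  have -> : v = m1 (z, false) t1 by rewrite -vE (lactK m1 (z, true)).
  by rewrite mYt1V; exists d; rewrite ev_mC ev_c0 j_agrees.
have [[[-> yz bE]|[fE yz bE]]|/mYr <- /=] :=
    pselect (crosses mC (t2, (z, false)) (y, b) f).
- by rewrite yz bE mYt2.
- move: fE; rewrite yz (negbFE bE) => fE.
  have -> : f = mC (z, false) t2 by rewrite -fE (lactK mC (z, true)).
  by rewrite mYt2V.
- by have [x xE] := Adc; exists x; rewrite ev_mC xE j_agrees.
Qed.

End SplicedFunctions.

Section Enclosing.
Variable K : choiceType.
Hypothesis two_letters : exists x y : K, x != y.

Definition loops_off_edge (ws : seq (word K)) :=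
  exists (T : finType) (m : letter_action K T) (d t : T) (z : K),
    connected m /\
    forall w, w \in ws -> wact m w d = d /\ avoids m (t, (z, false)) w d.

Lemma extension_enclosing (G : stage K) ws : loops_off_edge ws ->
  exists2 H, extends G H & forall i : 'I_(bound G), encloses H ws (val i).
Proof.
move=> [T [m [d [t [z [m_conn ws_loops]]]]]].
have [a az] := other_letter two_letters z.
have [W [mW [j [p [_ j_agrees _ _ p_off]]]]] := escape_permuting t m_conn az 1%g.
have [C [mC [ev [mC_conn ev_mC [c0 ev_c0]]]]] := diagonal_component mW j.
have [mY [mYl mYr mYt1 mYt2]] :=
  splice (sact G) mC (loose_source G) (mC (loose_letter G, true) c0) (loose_letter G).
have mY_conn := splice_connected (@sact_connected _ G) mC_conn mYl mYr mYt1.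
have mY_shadows := splice_shadows j_agrees ev_mC ev_c0 mYl mYr mYt1 mYt2.
have [b bG] := other_letter two_letters (loose_letter G).
pose c1 : 'I_(bound G) + C := inr (wact mC (positive p) c0).
have c1_missed d' : ~ meets j ev d' c1.
  move=> [x]; rewrite (equivariant_wact _ _ (ev_mC x)) ev_c0.
  by have [] := p_off x d'.
have inl_c1 i : inl i <> c1 by [].
have [H [phi [GH phi_mY phi_inj looseH phi_inl]]] :=
  stage_extension mY_conn (@inl_inj _ _) mYl (elimN eqP bG) inl_c1.
exists H => // i; exists (phi @` meets j ev d)%classic.
  by exists (phi (inl i)); [exists (inl i)|apply: phi_inl].
move=> w _ /ws_loops[wd w_off] [c Adc <-]; split.
  rewrite looseH; apply: equivariant_avoids => //.
  exact: shadows_avoids mY_shadows c1_missed w_off Adc.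
exists (wact mY w c); last exact: equivariant_wact.
by rewrite -{1}wd; apply: shadows_wact mY_shadows w_off Adc.
Qed.

End Enclosing.

(** * The limit of a chain of stages *)

Section Chain.
Variables (K : choiceType) (G : nat -> stage K).
Hypothesis G_ext : forall k, extends (G k) (G k.+1).

Lemma chain_extends i k : i < k -> extends (G i) (G k).
Proof.
elim: k => // k IH; rewrite ltnS leq_eqVlt => /predU1P[->//|/IH].
by move/extends_trans; apply.
Qed.

Lemma chain_bound k : k <= bound (G k).
Proof. by elim: k => // k IH; apply: leq_ltn_trans IH (extends_bound _). Qed.

Lemma chain_stable i k l v : v < bound (G i) -> i < k ->
  nat_action (sact (G k)) l v = nat_action (sact (G i.+1)) l v.
Proof.
move=> vi; rewrite leq_eqVlt => /predU1P[<-//|ik]; have := extends_bound (G_ext i).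
move=> /ltnW/(leq_trans vi) vi1; have [agree _ _] := chain_extends ik.
rewrite -[v]/(val (Ordinal vi1)) -agree; first by rewrite -nat_act_ord.
by apply: (extends_crosses (G_ext i)).
Qed.

Definition chain_act l v := nat_action (sact (G v.+2)) l v.

Lemma chain_actE i k l v : v < bound (G i) -> i < k ->
  chain_act l v = nat_action (sact (G k)) l v.
Proof.
move=> vi ik; have vv := chain_bound v.+1; pose n := maxn k v.+2.
rewrite (chain_stable l vi ik) -(chain_stable (k := n) l vi); last first.
  by rewrite leq_max ik.
by rewrite (chain_stable (i := v.+1) (k := n)) // leq_max leqnn orbT.
Qed.

Lemma chain_actK l : cancel (chain_act l) (chain_act (linv l)).
Proof.
move=> v; pose n := maxn v (chain_act l v); have := chain_bound n.+1.
move=> /(leq_ltn_trans _) n_lt; have n_lt_succ : n.+1 < n.+2 by [].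
rewrite (chain_actE (k := n.+2) _ (n_lt _ _) n_lt_succ) ?leq_max ?leqnn ?orbT //.
rewrite (chain_actE (k := n.+2) _ (n_lt _ _) n_lt_succ) ?leq_max ?leqnn //.
exact: lactK.
Qed.

Definition chain_action := LetterAction chain_actK.

Lemma chain_agrees k : agrees_off (sact (G k)) chain_action val (loose_edge (G k)).
Proof.
have [agree _ _] := G_ext k => l i /agree ->.
by rewrite /= (chain_actE l (ltn_ord i) (ltnSn k)).
Qed.

End Chain.

Definition finitely_enclosed (K : eqType) (T : Type) (m : letter_action K T)
    (ws : seq (word K)) (v : T) :=
  exists A : set T,
    [/\ finite_set A, A v & forall w u, w \in ws -> A u -> A (wact m w u)].

Section LimitProperties.
Variables (K : choiceType) (H : stage K) (m : letter_action K nat).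
Hypothesis agree : agrees_off (sact H) m val (loose_edge H).

Lemma carries_limit g u v : carries H g u v -> wact m g u = v.
Proof. by move=> [i [<- off <-]]; rewrite (agrees_off_wact agree off). Qed.

Lemma encloses_limit ws u : encloses H ws u -> finitely_enclosed m ws u.
Proof.
move=> [C [i Ci iu] wsC]; exists (val @` C)%classic; split.
- apply: (sub_finite_set _ (finite_II (bound H))) => _ [i' _ <-].
  exact: ltn_ord.
- by exists i.
- move=> w _ /wsC ws_w [i' Ci' <-]; have [off wC] := ws_w i' Ci'.
  by exists (wact (sact H) w i'); last exact: agrees_off_wact agree off.
Qed.

End LimitProperties.

Section LimitAction.
Variable K : countType.
Hypothesis two_letters : exists x y : K, x != y.

Definition point_action : letter_action K 'I_1 :=
  LetterAction (lact := fun _ => id) (fun _ _ => erefl).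

Lemma point_action_connected : connected point_action.
Proof. by move=> u v; exists [::]; rewrite [u]ord1 [v]ord1. Qed.

Lemma chain_exists (G0 : stage K) (R : nat -> stage K -> Prop) :
    (forall i G, exists2 H, extends G H & R i H) ->
  exists G : nat -> stage K, forall i, extends (G i) (G i.+1) /\ R i (G i.+1).
Proof.
move=> dense; have /choice[next nextP] (q : nat * stage K) :
    exists H, extends q.2 H /\ R q.1 H.
  by have [H] := dense q.1 q.2; exists H.
exists (fix G i := if i is i'.+1 then next (i', G i') else G0) => i.
exact: (nextP (i, _)).
Qed.

Lemma limit_action (C : countType) (R : C -> stage K -> Prop) :
    (forall c G, exists2 H, extends G H & R c H) ->
  exists m : letter_action K nat, forall c, exists2 H, R c H &
    agrees_off (sact H) m val (loose_edge H).
Proof.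
move=> dense; have [z _] := two_letters; pose G0 := Stage ord0 z point_action_connected.
pose R' i G := if unpickle i is Some c then R c G else True.
have [i G|G G_ext] := @chain_exists G0 R'.
  rewrite /R'; case: unpickle => [c|]; first exact: dense.
  by have [H GH] := extension_exists two_letters G; exists H.
exists (chain_action (fun i => (G_ext i).1)) => c.
exists (G (pickle c).+1); last exact: chain_agrees.
by have [_] := G_ext (pickle c); rewrite /R' pickleK.
Qed.

Lemma exists_generic_action : exists m : letter_action K nat,
  (forall ps : seq (nat * nat), bijective_pairs ps ->
    exists g, forall u v, (u, v) \in ps -> wact m g u = v) /\
  (forall ws u, loops_off_edge ws -> finitely_enclosed m ws u).
Proof.
pose R (c : seq (nat * nat) + seq (word K) * nat) (H : stage K) :=
  match c with
  | inl ps => bijective_pairs ps ->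
      exists g, forall u v, (u, v) \in ps -> carries H g u v
  | inr (ws, u) => loops_off_edge ws -> encloses H ws u
  end.
have [[ps|[ws u]] G|m mR] := @limit_action _ R.
- have [ps_bij|ps_nbij] := pselect (bijective_pairs ps).
    by have [H GH gH] := extension_carrying two_letters G ps_bij; exists H.
  by have [H GH] := extension_exists two_letters G; exists H.
- have [H GH uH] := extension_large two_letters G u.+1.
  have [ws_loops|ws_nloops] := pselect (loops_off_edge ws); last by exists H.
  have [I HI encI] := extension_enclosing two_letters H ws_loops.
  by exists I => [|_]; [apply: extends_trans HI|apply: (encI (Ordinal uH))].
exists m; split=> [ps ps_bij|ws u ws_loops].
  have [H RH agree] := mR (inl ps); have [g gH] := RH ps_bij.
  by exists g => u v /gH; apply: carries_limit.
have [H RH agree] := mR (inr (ws, u)).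
by apply: (encloses_limit agree); apply: RH.
Qed.

End LimitAction.

(** * Words and groups *)

Local Open Scope classical_set_scope.

Section Evaluation.
Variables (F : groupType) (K : Type) (f : K -> F).
Implicit Types w : word K.

Definition eval w : F := (\prod_(l <- w) (if l.2 then (f l.1)^-1 else f l.1))%g.

Lemma eval_nil : eval [::] = 1%g.
Proof. exact: big_nil. Qed.

Lemma eval_cat w w' : eval (w ++ w') = (eval w * eval w')%g.
Proof. exact: big_cat. Qed.

Lemma eval_cons l w : eval (l :: w) = (eval [:: l] * eval w)%g.
Proof. exact: (eval_cat [:: l]). Qed.

Lemma eval_linv l : eval [:: linv l] = (eval [:: l])^-1%g.
Proof. by case: l => y []; rewrite /eval !big_seq1 /= ?invgK. Qed.

Lemma eval_winv w : eval (winv w) = (eval w)^-1%g.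
Proof.
elim: w => [|l w IH]; first by rewrite eval_nil invg1.
by rewrite winv_cons -cats1 eval_cat IH [in RHS]eval_cons invgM eval_linv.
Qed.

Section Pullback.
Variables (S : Type) (a : group_action F S).

Definition pullback_act l s := a (eval [:: l]) s.

Lemma pullback_actK l : cancel (pullback_act l) (pullback_act (linv l)).
Proof. by move=> s; rewrite /pullback_act -actM eval_linv mulVg act1. Qed.

Definition pullback := LetterAction pullback_actK.

Lemma wact_pullback w s : wact pullback w s = a (eval w) s.
Proof.
elim: w => [|l w IH] /=; first by rewrite eval_nil act1.
by rewrite IH eval_cons actM.
Qed.

End Pullback.

(* Universal property: every letter action factors through [F]. *)
Definition freely_generates :=
  (forall g, exists w, eval w = g) /\
  forall (T : Type) (m : letter_action K T) w w',
    eval w = eval w' -> wact m w =1 wact m w'.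

Lemma free_action (T : Type) (m : letter_action K T) : freely_generates ->
  exists a : group_action F T, forall w v, a (eval w) v = wact m w v.
Proof.
move=> [/choice[wd wdK] free]; pose act g := wact m (wd g).
have actE w v : act (eval w) v = wact m w v by apply: free; rewrite wdK.
have act1 v : act 1%g v = v by rewrite -eval_nil actE.
have actM g h v : act (g * h)%g v = act g (act h v).
  by rewrite -[in LHS](wdK g) -[in LHS](wdK h) -eval_cat actE wact_cat.
by exists (GroupAction act1 actM).
Qed.

End Evaluation.

Section SubgroupValues.
Variables (F : groupType) (K : eqType) (f : K -> F).

Lemma subgroup_eval (B : set F) w :
  is_subgroup B -> (forall l, l \in w -> B (f l.1)) -> B (eval f w).
Proof.
move=> [B1 BM BV]; elim: w => [|[y b] w IH] Bw; first by rewrite eval_nil.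
rewrite eval_cons; apply: BM; last by apply: IH => l lw; apply: Bw; rewrite inE lw orbT.
have By : B (f y) := Bw (y, b) (mem_head _ _).
by rewrite /eval big_seq1 /=; case: b {Bw}; [apply: BV|].
Qed.

Lemma two_generators : (forall g, exists w, eval f w = g) -> ~ is_cyclic [set: F] ->
  exists x y : K, x != y.
Proof.
move=> eval_surj; apply: contra_notP => one.
have {one} all_eq (x y : K) : x = y.
  by apply: contrapT => /eqP xy; apply: one; exists x, y.
have [c fc] : exists c, forall y, f y = c.
  have [[x _]|noK] := pselect (exists x : K, True).
    by exists (f x) => y; rewrite (all_eq y x).
  by exists 1%g => y; case: noK; exists y.
exists c; apply/seteqP; split=> // g _ B [B_sub Bc]; have [w <-] := eval_surj g.
by apply: subgroup_eval => // l _; apply: Bc; rewrite fc.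
Qed.

End SubgroupValues.

Section Cosets.
Variables (F : groupType) (L : set F).

Lemma left_coset1 (A : set F) : left_coset 1%g A = A.
Proof.
by apply/seteqP; split=> [_ [x Ax <-]|x Ax]; [|exists x]; rewrite ?mul1g.
Qed.

Lemma left_cosetM g h (A : set F) :
  left_coset (g * h)%g A = left_coset g (left_coset h A).
Proof.
apply/seteqP; split=> [_ [x Ax <-]|_ [_ [x Ax <-] <-]]; last first.
  by exists x; rewrite ?mulgA.
by exists (h * x)%g; rewrite ?mulgA //; exists x.
Qed.

Definition coset_action : group_action F (set F) := GroupAction left_coset1 left_cosetM.

Lemma left_coset_id g : is_subgroup L -> L g -> left_coset g L = L.
Proof.
move=> [L1 LM LV] Lg; apply/seteqP; split=> [_ [x Lx <-]|x Lx]; first exact: LM.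
by exists (g^-1 * x)%g; rewrite ?mulVKg //; apply: LM Lx; apply: LV.
Qed.

Lemma infinite_index_orbit (S : Type) (a : group_action F S) s :
    (forall g, L g -> a g s = s) -> L 1%g -> infinite_set [set a g s | g in [set: F]] ->
  infinite_index L.
Proof.
move=> Ls L1 orbit_inf index_fin; apply: orbit_inf.
pose endpoint (c : set F) := a (xget 1%g c) s.
apply: sub_finite_set (finite_image endpoint index_fin) => _ [g _ <-].
exists (left_coset g L); first by exists g.
rewrite /endpoint; have [h Lh <-] : left_coset g L (xget 1%g (left_coset g L)).
  by apply: xgetPex; exists g; exists 1%g; rewrite ?mulg1.
by rewrite actM Ls.
Qed.

End Cosets.

Lemma generated_stable (F : groupType) (S : Type) (a : group_action F S) (A : set F)
    (C : set S) g s :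
    (forall h u, A h -> C u -> C (a h u) /\ C (a h^-1%g u)) ->
  generated A g -> C s -> C (a g s).
Proof.
move=> AC Ag; pose stab h := forall u, C u -> C (a h u) /\ C (a h^-1%g u).
suff /(_ s) stab_g : stab g by move=> /stab_g[].
apply: (Ag stab); split=> [|h Ah u]; last exact: AC.
split=> [u|h k stab_h stab_k u Cu|h stab_h u /stab_h].
- by rewrite invg1 !act1.
- rewrite invgM !actM; split; first by have [] := stab_h _ (stab_k u Cu).1.
  by have [] := stab_k _ (stab_h u Cu).2.
- by rewrite invgK => -[].
Qed.

(** * Finitely many loops at a point with infinite orbit *)

Section Exits.
Variables (K : eqType) (Y : choiceType) (m : letter_action K Y) (D : seq Y).

Lemma induced_action : exists m' : letter_action K (seq_sub D),
  forall l u v, m l (val u) = val v -> m' l u = v.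
Proof.
have [y|m' m'E] := @letter_action_completion K (seq_sub D)
    (fun y u v => m (y, false) (val u) = val v).
  move=> u u' v v' uv u'v'; split=> [uE|vE]; apply: val_inj.
    by rewrite -uv -u'v' uE.
  by apply: (lact_inj m (y, false)); rewrite uv u'v' vE.
exists m' => -[y []] u v uv; last exact: m'E.
rewrite -[v](lactK m' (y, false)); congr (m' _ _); apply/esym/m'E.
by rewrite -uv (lactK m (y, true)).
Qed.

Lemma infinite_orbit_exit x :
    x \in D -> infinite_set [set wact m w x | w in [set: word K]] ->
  exists (t : seq_sub D) z, m (z, false) (val t) \notin D.
Proof.
move=> xD orbit_inf; apply: contrapT => no_exit; apply: orbit_inf.
have stays y (u : seq_sub D) : m (y, false) (val u) \in D.
  by apply: contrapT => /negP exit; apply: no_exit; exists u, y.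
have [m' m'E] := induced_action.
have val_m' : equivariant m' m val.
  by apply: equivariant_positive => y u; rewrite (m'E _ _ (SeqSub (stays y u))).
apply: sub_finite_set (finite_seq D) => _ [w _ <-] /=.
by rewrite -[x]/(val (SeqSub xD)) -(equivariant_wact w _ val_m'); apply: ssvalP.
Qed.

Lemma induced_run (m' : letter_action K (seq_sub D)) (t x : seq_sub D) z w :
    (forall l u v, m l (val u) = val v -> m' l u = v) ->
    m (z, false) (val t) \notin D ->
    (forall q, suffix q w -> wact m q (val x) \in D) ->
  val (wact m' w x) = wact m w (val x) /\ avoids m' (t, (z, false)) w x.
Proof.
move=> m'E exit; elim: w => [|[y b] w IH] wD; first by [].
have lD := wD _ (suffix_refl _); have uD := wD _ (suffix_cons _ _).
have [q qw|wE w_off] := IH; first exact/wD/(suffix_trans qw)/suffix_cons.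
have lE : wact m' ((y, b) :: w) x = SeqSub lD by apply: m'E; rewrite wE.
split; first by rewrite lE.
split=> // -[[tE yz bE]|[tE yz /negbFE bE]]; move: exit; rewrite -tE -yz.
  by rewrite wE -bE lD.
by rewrite [m' _ _]lE /= bE (lactK m (y, true)) uD.
Qed.

End Exits.

Lemma loops_off_edge_infinite_orbit (K Y : choiceType) (m : letter_action K Y) x ws :
    infinite_set [set wact m w x | w in [set: word K]] ->
    (forall w, w \in ws -> wact m w x = x) ->
  loops_off_edge ws.
Proof.
move=> orbit_inf ws_x.
pose D := [seq wact m q x | w <- [::] :: ws, q <- suffixes w].
have DE w q : w \in [::] :: ws -> suffix q w -> wact m q x \in D.
  by move=> w_in qw; apply/allpairsPdep; exists w, q; rewrite mem_suffixes.
have xD : x \in D := DE [::] [::] (mem_head _ _) (suffix_refl _).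
have [t [z exit]] := infinite_orbit_exit xD orbit_inf.
have [m' m'E] := induced_action m D.
have run w q : w \in [::] :: ws -> suffix q w ->
    val (wact m' q (SeqSub xD)) = wact m q x /\ avoids m' (t, (z, false)) q (SeqSub xD).
  move=> w_in qw; apply: (induced_run m'E exit) => q' q'q.
  exact: DE w_in (suffix_trans q'q qw).
exists (seq_sub D), m', (SeqSub xD), t, z; split=> [|w w_in].
  apply: (@connected_of_root _ _ _ (SeqSub xD)) => u.
  have /allpairsPdep[w [q [w_in qw uE]]] := ssvalP u; rewrite mem_suffixes in qw.
  by exists q; apply: val_inj; rewrite [RHS]uE; have [] := run w q w_in qw.
have w_in' : w \in [::] :: ws by rewrite inE w_in orbT.
have [wE w_off] := run w w w_in' (suffix_refl w); split=> //.
by apply: val_inj; rewrite wE ws_x.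
Qed.

Definition locally_finite_at_infinite_index (F : groupType) (S : Type)
    (a : group_action F S) :=
  forall L : set F, is_subgroup L -> finitely_generated L -> infinite_index L ->
    locally_finite_on a L.

Lemma highly_transitive_pairs (F : groupType) (S : eqType) (a : group_action F S) :
    (forall ps : seq (S * S), bijective_pairs ps ->
      exists g, forall u v, (u, v) \in ps -> a g u = v) ->
  highly_transitive a.
Proof.
move=> a_ps k _ s s' s_inj s'_inj.
have [|g gP] := a_ps [seq (s i, s' i) | i <- enum 'I_k].
  move=> _ _ _ _ /mapP[i _ [-> ->]] /mapP[i' _ [-> ->]].
  by split=> [/s_inj->|/s'_inj->].
by exists g => i; apply: gP; apply/mapP; exists i; rewrite ?mem_enum.
Qed.

Section ExistenceForFreeGroups.
Variables (F : groupType) (K : countType) (f : K -> F).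
Hypotheses (f_free : freely_generates f) (two_letters : exists x y : K, x != y).

Lemma loops_off_edge_infinite_index (L : set F) ws : is_subgroup L ->
    infinite_index L -> (forall w, w \in ws -> L (eval f w)) ->
  loops_off_edge ws.
Proof.
move=> L_sub L_inf ws_L; pose m := pullback f (coset_action F).
apply: (@loops_off_edge_infinite_orbit _ _ m L) => [m_fin|w /ws_L Lw].
  apply: L_inf; apply: sub_finite_set m_fin => _ [g _ <-].
  by have [w <-] := f_free.1 g; exists w => //; rewrite wact_pullback.
by rewrite wact_pullback; apply: left_coset_id.
Qed.

Lemma locally_finite_enclosed (S : Type) (a : group_action F S) (L : set F) :
    (forall ws, (forall w, w \in ws -> L (eval f w)) ->
      forall s, finitely_enclosed (pullback f a) ws s) ->
    is_subgroup L -> finitely_generated L ->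
  locally_finite_on a L.
Proof.
move=> enclosed [_ _ LV] [X X_fin LX] s; have [xs XE] := (finite_seqP X).1 X_fin.
have /choice[wd wdK] := f_free.1.
pose ws := [seq wd x | x <- xs] ++ [seq winv (wd x) | x <- xs].
have xsL x : x \in xs -> L x by move=> x_in; rewrite LX => B [_]; apply; rewrite XE.
have [|A [A_fin As wsA]] := enclosed ws _ s.
  move=> w; rewrite mem_cat => /orP[] /mapP[x /xsL Lx ->]; first by rewrite wdK.
  by rewrite eval_winv wdK; apply: LV.
apply: sub_finite_set A_fin => _ [g Lg <-]; rewrite LX in Lg.
apply: generated_stable Lg As => x v; rewrite XE /= => x_in Av.
rewrite -[x]wdK -eval_winv -!wact_pullback.
split; apply: wsA => //; rewrite mem_cat.
  by rewrite map_f.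
by rewrite (map_f (fun x => winv (wd x))) ?orbT.
Qed.

Lemma exists_highly_transitive_locally_finite_action :
  exists (S : Type) (a : group_action F S),
    [/\ infinite_set [set: S], highly_transitive a
      & locally_finite_at_infinite_index a].
Proof.
have [m [m_ps m_ws]] := exists_generic_action two_letters.
have [a aE] := free_action m f_free; exists nat, a; split=> [||L L_sub L_fg L_inf].
- exact: infinite_nat.
- apply: highly_transitive_pairs => ps /m_ps[g gP].
  by exists (eval f g) => u v /gP; rewrite aE.
- apply: locally_finite_enclosed => // ws ws_L s.
  have [A [A_fin As wsA]] := m_ws _ s (loops_off_edge_infinite_index L_sub L_inf ws_L).
  by exists A; split=> // w v; rewrite wact_pullback aE; apply: wsA.
Qed.

End ExistenceForFreeGroups.

(** * Faithfulness *)

Section CyclicallyReducedWords.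
Variable K : eqType.
Implicit Types (l : letter K) (w r : word K).

Definition noncancelling l l' := l' != linv l.

Lemma cancelling_pair w : ~~ sorted noncancelling w ->
  exists w1 l w2, w = w1 ++ [:: l, linv l & w2].
Proof.
elim: w => //= l [|l' w] //= IH; rewrite negb_and => /orP[/negPn/eqP ->|/IH].
  by exists [::], l, w.
by move=> [w1 [l1 [w2 ->]]]; exists (l :: w1), l1, w2.
Qed.

Lemma exists_sorted_noncancelling w : exists w',
  [/\ sorted noncancelling w', {subset w' <= w},
      forall (F : groupType) (f : K -> F), eval f w' = eval f w
    & forall (T : Type) (m : letter_action K T), wact m w' =1 wact m w].
Proof.
have [n] := ubnP (size w); elim: n w => // n IH w w_n.
have [w_sorted|/cancelling_pair[w1 [l [w2 wE]]]] := boolP (sorted noncancelling w).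
  by exists w; split.
have [|w' [w'_sorted w'_sub w'_eval w'_act]] := IH (w1 ++ w2).
  by move: w_n; rewrite wE !size_cat /=; lia.
exists w'; split=> // [l' /w'_sub|F f|T m v].
- by rewrite wE !mem_cat !inE => /orP[] ->; rewrite ?orbT.
- rewrite w'_eval wE !eval_cat eval_cons [eval f (linv l :: _)]eval_cons.
  by rewrite eval_linv mulVKg.
- by rewrite w'_act wE !wact_cat /= lactKV.
Qed.

Lemma shortest_cyclically_reduced (P : word K -> Prop) :
    (forall w1 w2, P (w1 ++ w2) -> P (w2 ++ w1)) ->
    (forall w1 l w2, P (w1 ++ [:: l, linv l & w2]) -> P (w1 ++ w2)) ->
    (exists w, P w) ->
  exists2 w, P w & cycle noncancelling w.
Proof.
move=> P_rot P_cancel [w0 Pw0].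
have exP : exists k, `[< exists2 w, P w & size w = k >].
  by exists (size w0); apply/asboolP; exists w0.
case: (ex_minnP exP) => k /asboolP[w Pw wk] k_min; exists w => //.
have P_sorted v : P v -> size v = k -> sorted noncancelling v.
  move=> Pv vk; apply: contraPT Pv => /cancelling_pair[w1 [l [w2 vE]]].
  rewrite vE => /P_cancel P12; have : k <= size (w1 ++ w2).
    by apply: k_min; apply/asboolP; exists (w1 ++ w2).
  by rewrite -vk vE !size_cat /=; lia.
case: w Pw wk => // l w Pw wk; rewrite /= rcons_path; have /= -> /= := P_sorted _ Pw wk.
case/lastP: w Pw wk => [_ _|w x Pw wk]; first by case: l => y []; apply/eqP.
rewrite last_rcons; move: Pw wk; rewrite -cats1 -cat_cons => /P_rot/P_sorted.
rewrite !size_cat addnC => sorted_rot /sorted_rot.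
by case/andP.
Qed.

Lemma cycle_nth (T : Type) (e : rel T) x0 s i : cycle e s -> i < size s ->
  e (nth x0 s i) (nth x0 s (i.+1 %% size s)).
Proof.
case: s => // x s /(pathP x0) s_cycle is_; have := s_cycle i; rewrite size_rcons.
move=> /(_ is_); rewrite nth_rcons -rcons_cons nth_rcons is_.
move: is_; rewrite ltnS leq_eqVlt => /predU1P[->|is_]; last first.
  by rewrite modn_small // is_.
by rewrite ltnn eqxx modnn.
Qed.

Section CyclicAction.
Variables (r : word K) (l0 : letter K).
Hypothesis rl0_cycle : cycle noncancelling (rcons r l0).

Let n := size r.
Let W (i : 'I_n.+1) := nth l0 (rcons r l0) i.

Lemma cyclic_nth_noncancelling i : W (ordS i) <> linv (W i).
Proof.
have i_lt : i < size (rcons r l0) by rewrite size_rcons.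
by have := cycle_nth l0 rl0_cycle i_lt; rewrite size_rcons => /eqP.
Qed.

Lemma cyclic_word_action : exists m : letter_action K 'I_n.+1,
  forall i, m (W i) (ordS i) = i.
Proof.
pose R y u v := u = ordS v /\ W v = (y, false) \/ v = ordS u /\ W u = (y, true).
have mixed u v u' v' y : u = ordS v -> W v = (y, false) -> v' = ordS u' ->
    W u' = (y, true) -> u <> u' /\ v <> v'.
  move=> uE Wv v'E Wu'; split=> [uu'|vv'].
    by apply: (@cyclic_nth_noncancelling v); rewrite -uE uu' Wv Wu'.
  by apply: (@cyclic_nth_noncancelling u'); rewrite -v'E -vv' Wv Wu'.
have [y u u' v v'|m mR] := @letter_action_completion K _ R.
  move=> [[uE Wv]|[vE Wu]] [[u'E Wv']|[v'E Wu']].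
  - by rewrite uE u'E; split=> [/ordS_inj|->].
  - by have [uu' vv'] := mixed _ _ _ _ _ uE Wv v'E Wu'; split=> [/uu'|/vv'].
  - have [uu' vv'] := mixed _ _ _ _ _ u'E Wv' vE Wu.
    by split=> /esym => [/uu'|/vv'].
  - by rewrite vE v'E; split=> [->|/ordS_inj].
exists m => i; case Wi: (W i) => [y []]; last by apply: mR; left.
by rewrite -{1}(mR y i (ordS i)) ?(lactK m (y, false)) //; right.
Qed.

Lemma cyclic_word_loop : exists (T : finType) (m : letter_action K T) (t : T),
  wact m r (m l0 t) = t /\ avoids m (t, l0) r (m l0 t).
Proof.
have [m mW] := cyclic_word_action; exists 'I_n.+1, m, ord0.
have ordS_n : ordS (inord n) = ord0 :> 'I_n.+1.
  by apply: val_inj; rewrite /= inordK ?modnn.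
have W_n : W (inord n) = l0 by rewrite /W inordK // nth_rcons ltnn eqxx.
have start : m l0 ord0 = inord n by rewrite -W_n -ordS_n mW.
have ordS_lt i : i < n -> ordS (inord i) = inord i.+1 :> 'I_n.+1.
  by move=> i_n; apply: val_inj; rewrite /= !inordK ?modn_small // ltnS ltnW.
have W_lt i : i < n -> W (inord i) = nth l0 r i.
  by move=> i_n; rewrite /W inordK ?nth_rcons ?i_n // ltnS ltnW.
have arc k i : i + k = n ->
    wact m (drop i r) (inord n) = inord i /\ avoids m (ord0, l0) (drop i r) (inord n).
  elim: k i => [i|k IH i ikn]; first by rewrite addn0 => ->; rewrite drop_size.
  have i_n : i < n by rewrite -ikn addnS ltnS leq_addr.
  rewrite (drop_nth l0) //=; have [|-> arc_off] := IH i.+1; first by rewrite addSnnS.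
  have step : m (nth l0 r i) (inord i.+1) = inord i by rewrite -W_lt // -ordS_lt // mW.
  split=> //; split=> // -[[/(congr1 val)]|]; first by rewrite /= inordK.
  rewrite step => -[i0 lE]; case: (@cyclic_nth_noncancelling (inord n)).
  by rewrite ordS_n W_n -i0 W_lt // -[l0 in RHS]lE linvK.
rewrite start -[r]drop0; have [-> r_off] := arc n 0 (add0n n); split=> //.
by apply: val_inj; rewrite /= inordK.
Qed.

End CyclicAction.
End CyclicallyReducedWords.

Arguments noncancelling {K}.

Section OffEdgePaths.
Variables (F : groupType) (K T : eqType) (f : K -> F).
Variables (m : letter_action K T) (t : T) (l0 : letter K).

Definition off_edge_paths v : set F :=
  [set eval f w | w in [set w | wact m w t = v /\ avoids m (t, l0) w t]].

Lemma off_edge_subgroup : is_subgroup (off_edge_paths t).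
Proof.
split=> [|_ _ [u [ut u_off] <-] [w [wt w_off] <-]|_ [u [ut u_off] <-]].
- by exists [::]; rewrite ?eval_nil.
- exists (u ++ w); last exact: eval_cat.
  by split; [rewrite wact_cat wt|apply/avoids_cat; rewrite wt].
- exists (winv u); last exact: eval_winv.
  have /= u_inv := avoids_winv u_off; rewrite ut in u_inv.
  by split=> //; rewrite -{1}ut wactK.
Qed.

Lemma off_edge_paths_coset v :
  exists h : F, forall g, off_edge_paths v g -> off_edge_paths t (h^-1 * g)%g.
Proof.
have [[_ [p [pv p_off] _]]|no_path] :=
    pselect (exists h, off_edge_paths v h); last first.
  by exists 1%g => g g_path; case: no_path; exists g.
exists (eval f p) => _ [u [uv u_off] <-]; exists (winv p ++ u); last first.
  by rewrite eval_cat eval_winv.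
split; first by rewrite wact_cat uv -pv wactK.
by apply/avoids_cat; split=> //; rewrite uv -pv; apply: avoids_winv.
Qed.

Lemma off_edge_transversal : exists p : T -> word K, p t = [::] /\
  forall w, avoids m (t, l0) w t ->
    wact m (p (wact m w t)) t = wact m w t /\ avoids m (t, l0) (p (wact m w t)) t.
Proof.
have /choice[p pP] v : exists p, (v = t -> p = [::]) /\
    forall w, avoids m (t, l0) w t -> wact m w t = v ->
      wact m p t = v /\ avoids m (t, l0) p t.
  have [->|/eqP vt] := eqVneq v t; first by exists [::].
  have [[p [p_off pv]]|no_path] :=
      pselect (exists p, avoids m (t, l0) p t /\ wact m p t = v).
    by exists p; split=> // /vt.
  by exists [::]; split=> // w w_off wv; case: no_path; exists w.
by exists p; split=> [|w w_off]; [apply: (pP t).1|apply: (pP _).2 w_off erefl].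
Qed.

Section SchreierGenerators.
Variable p : T -> word K.

Definition schreier_word l v := winv (p (m l v)) ++ l :: p v.

Lemma schreier_rewriting (B : set F) : p t = [::] -> is_subgroup B ->
    (forall l w, avoids m (t, l0) (l :: w) t ->
      B (eval f (schreier_word l (wact m w t)))) ->
  forall w, avoids m (t, l0) w t -> B ((eval f (p (wact m w t)))^-1 * eval f w)%g.
Proof.
move=> pt [B1 BM _] Bgen; elim=> [_|l w IH lw_off]; first by rewrite /= pt mulVg.
have := BM _ _ (Bgen l w lw_off) (IH lw_off.1).
rewrite eval_cat eval_winv [eval f (l :: _)]eval_cons -!mulgA mulVKg.
by rewrite -eval_cons.
Qed.

Lemma schreier_word_off w l :
    (forall w, avoids m (t, l0) w t ->
      wact m (p (wact m w t)) t = wact m w t /\ avoids m (t, l0) (p (wact m w t)) t) ->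
    avoids m (t, l0) (l :: w) t ->
  wact m (schreier_word l (wact m w t)) t = t /\
  avoids m (t, l0) (schreier_word l (wact m w t)) t.
Proof.
move=> pP lw_off; have [pw pw_off] := pP w lw_off.1; have [plw plw_off] := pP _ lw_off.
have end_lp : m l (wact m (p (wact m w t)) t) = wact m (p (m l (wact m w t))) t.
  by rewrite pw; apply/esym/plw.
split; first by rewrite wact_cat /= end_lp wactK.
apply/avoids_cat; split; last by rewrite /= end_lp; apply: avoids_winv.
by split=> //; rewrite pw; case: lw_off.
Qed.

End SchreierGenerators.

Section DetouredEdge.
Variable r : word K.
Hypotheses (rt : wact m r (m l0 t) = t) (r_off : avoids m (t, l0) r (m l0 t)).

Lemma off_edge_replacement (S : Type) (n : letter_action K S) :
    (forall s, wact n r (n l0 s) = s) ->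
  forall w, exists2 u, avoids m (t, l0) u t & wact n u =1 wact n w.
Proof.
move=> nr; elim=> [|l w [u u_off uw]]; first by exists [::].
have [[[ut ->]|[ut lE]]|not_crossed] := pselect (crosses m (t, l0) l (wact m u t)).
- exists (winv r ++ u) => [|s]; last by rewrite wact_cat uw -[RHS](wactK n r) nr.
  apply/avoids_cat; split=> //; rewrite ut.
  by have := avoids_winv r_off; rewrite rt.
- have {}lE : l = linv l0 by rewrite -lE linvK.
  exists (r ++ u) => [|s]; last first.
    by rewrite wact_cat uw -[X in wact n r X](lactKV n l0) nr /= lE.
  by apply/avoids_cat; split=> //; rewrite -[wact m u t](lactK m l) ut lE linvK.
- by exists (l :: u) => // s; rewrite /= uw.
Qed.

(* The integer counts the signed crossings of the edge. *)
Lemma winding_action : exists m' : letter_action K (T * int),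
  (forall k, agrees_off m m' (pair^~ k) (t, l0)) /\
  forall k, m' l0 (t, k) = (m l0 t, (k + 1)%R).
Proof.
pose delta l v : int :=
  (((v, l) == (t, l0))%:R - ((m l v, linv l) == (t, l0))%:R)%R.
pose act l (x : T * int) := (m l x.1, (x.2 + delta l x.1)%R).
have actK l : cancel (act l) (act (linv l)).
  move=> [v k]; rewrite /act /= lactK /delta lactK linvK; congr (_, _).
  by rewrite -GRing.addrA GRing.subrKA GRing.subrr GRing.addr0.
exists (LetterAction actK); split=> [k l v off|k]; rewrite /= /act /delta /=.
  rewrite !(introF eqP) ?GRing.subr0 ?GRing.addr0 // => edgeE; apply: off.
    by right.
  by left.
rewrite eqxx [X in (1 - X)%R](_ : _ = 0%R) ?GRing.subr0 //; case: eqP => // -[_].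
by case: l0 => y [].
Qed.

Lemma off_edge_infinite_index : freely_generates f -> infinite_index (off_edge_paths t).
Proof.
move=> f_free; have [m' [m'_off m'_edge]] := winding_action.
have [a aE] := free_action m' f_free; pose g := eval f (rcons r l0).
have g_shift k : a g (t, k) = (t, (k + 1)%R).
  rewrite aE -cats1 wact_cat /= m'_edge.
  by rewrite -(agrees_off_wact (m'_off _) r_off) rt.
apply: (@infinite_index_orbit _ _ _ a (t, 0%R)).
- by move=> _ [w [wt w_off] <-]; rewrite aE -(agrees_off_wact (m'_off _) w_off) wt.
- by case: off_edge_subgroup.
move=> orbit_fin; apply: infinite_nat.
apply: sub_finite_set (finite_image (fun x => absz x.2) orbit_fin) => n _.
exists (a (g ^+ n)%g (t, 0%R)); first by exists (g ^+ n)%g.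
suff -> : a (g ^+ n)%g (t, 0%R) = (t, Posz n) by [].
elim: n => [|n IH]; first by rewrite expg0 act1.
by rewrite expgS actM IH g_shift; congr pair; lia.
Qed.

End DetouredEdge.
End OffEdgePaths.

Section FiniteOffEdgePaths.
Variables (F : groupType) (K T : finType) (f : K -> F).
Variables (m : letter_action K T) (t : T) (l0 : letter K).

Lemma off_edge_finitely_generated :
  finitely_generated (off_edge_paths f m t l0 t).
Proof.
have [p [pt pP]]  := off_edge_transversal m t l0.
pose ends : set (T * letter K) :=
  [set x | exists2 w, avoids m (t, l0) (x.2 :: w) t & wact m w t = x.1].
exists [set eval f (schreier_word m p x.2 x.1) | x in ends].
  exact/finite_image/finite_finset.
apply/seteqP; split=> [_ [w [wt w_off] <-] B [B_sub B_gen]|].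
  have := schreier_rewriting (f := f) pt B_sub _ w_off.
  rewrite wt pt eval_nil invg1 mul1g.
  by apply=> l u lu_off; apply: B_gen; exists (wact m u t, l) => //; exists u.
move=> g; apply; split; first exact: off_edge_subgroup.
move=> _ [[v l] [w lw_off /= <-] <-].
by exists (schreier_word m p l (wact m w t)) => //; apply: schreier_word_off.
Qed.

Lemma off_edge_orbit_cover (S : Type) (a : group_action F S) r s :
    wact m r (m l0 t) = t -> avoids m (t, l0) r (m l0 t) ->
    (forall g, exists w, eval f w = g) ->
    (forall s, a (eval f (rcons r l0)) s = s) ->
    finite_set (orbit_under a (off_edge_paths f m t l0 t) s) ->
  finite_set [set a g s | g in [set: F]].
Proof.
move=> rt r_off eval_surj a_loop orbit_fin.
have /choice[h h_coset] := off_edge_paths_coset f m t l0.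
apply: sub_finite_set (_ : finite_set (\bigcup_(v in [set: T])
  (a (h v) @` orbit_under a (off_edge_paths f m t l0 t) s))); last first.
  by apply: bigcup_finite => [|v _]; [exact: finite_finset|exact: finite_image].
move=> _ [g _ <-]; have [w <-] := eval_surj g.
have loop_id s' : wact (pullback f a) r (pullback f a l0 s') = s'.
  by rewrite -[RHS](a_loop s') -wact_pullback -cats1 wact_cat.
have [u u_off uw] := off_edge_replacement rt r_off loop_id w; pose v := wact m u t.
exists v => //; exists (a ((h v)^-1 * eval f u)%g s).
  by exists ((h v)^-1 * eval f u)%g => //; apply: h_coset; exists u.
by rewrite -actM mulVKg -!wact_pullback uw.
Qed.

End FiniteOffEdgePaths.

Lemma kernel_cyclically_reduced_word (F : groupType) (K : eqType) (f : K -> F)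
    (S : Type) (a : group_action F S) :
    (forall g, exists w, eval f w = g) -> ~ faithful_action a ->
  exists (r : word K) l0,
    cycle noncancelling (rcons r l0) /\ forall s, a (eval f (rcons r l0)) s = s.
Proof.
move=> eval_surj not_faithful.
pose P w := eval f w <> 1%g /\ action_kernel a (eval f w).
have [|||w [w1 w_ker] w_cycle] := @shortest_cyclically_reduced _ P.
- move=> w1 w2; rewrite /P !eval_cat => -[w_neq1 w_ker]; split.
    by move=> /(canRL (mulgK _)) w2E; apply: w_neq1; rewrite w2E mul1g mulgV.
  move=> s; rewrite -(mulKg (eval f w1) (eval f w2 * eval f w1)%g) (mulgA (eval f w1)).
  by rewrite !actM -[a (eval f w1) (a (eval f w2) _)]actM w_ker -actM mulVg act1.
- move=> w1 l w2; rewrite /P !eval_cat eval_cons [eval f (linv l :: _)]eval_cons.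
  by rewrite eval_linv mulVKg.
- apply: contrapT => no_word; apply: not_faithful.
  apply/seteqP; split=> [g g_ker|_ -> s].
    apply: contrapT => g1; apply: no_word; have [w wg] := eval_surj g.
    by exists w; rewrite /P wg.
  exact: act1.
case/lastP: w w1 w_ker w_cycle => [|r l0 _ w_ker w_cycle]; first by rewrite eval_nil.
by exists r, l0.
Qed.

Lemma faithful_of_locally_finite (F : groupType) (K : finType) (f : K -> F)
    (S : Type) (a : group_action F S) :
    freely_generates f -> infinite_set [set: S] -> k_transitive a 1 ->
    locally_finite_at_infinite_index a ->
  faithful_action a.
Proof.
move=> f_free S_inf a_trans a_lf; apply: contrapT.
move=> /(kernel_cyclically_reduced_word f_free.1)[r [l0 [rl0_cycle a_loop]]].
have [T [m [t [rt r_off]]]] := cyclic_word_loop rl0_cycle.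
have L_lf := a_lf _ (off_edge_subgroup f m t l0) (off_edge_finitely_generated f m t l0)
  (off_edge_infinite_index rt r_off f_free).
have [s _] := infinite_setN0 S_inf; apply: S_inf.
apply: sub_finite_set (off_edge_orbit_cover rt r_off f_free.1 a_loop (L_lf s)) => s' _.
have [||g /(_ ord0) <-] := a_trans (fun=> s) (fun=> s'); last by exists g.
- by move=> i j _; rewrite !ord1.
- by move=> i j _; rewrite !ord1.
Qed.

(** * Free bases *)

Section FreeBases.
Variable F : groupType.
Implicit Types (X Y : set F) (w : word F).

Lemma word_valueE w : word_value w = eval id w.
Proof. by []. Qed.

Lemma reducedE w : reduced w = sorted noncancelling w.
Proof.
apply: eq_sorted => -[x b] [y c]; rewrite /noncancelling /linv xpair_eqE /= eq_sym.
by case: b c => -[].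
Qed.

Lemma free_basis_uniq X w w' : free_basis X -> word_over X w -> word_over X w' ->
  reduced w -> reduced w' -> word_value w = word_value w' -> w = w'.
Proof.
move=> X_basis Xw Xw' w_red w'_red ww'.
by have [u [_ u_uniq]] := X_basis (word_value w); rewrite -(u_uniq w) // -(u_uniq w').
Qed.

Lemma word_over_subgroup Y :
  is_subgroup [set word_value w | w in [set w | word_over Y w]].
Proof.
split=> [|_ _ [w Yw <-] [w' Yw' <-]|_ [w Yw <-]].
- by exists [::]; rewrite // word_valueE eval_nil.
- exists (w ++ w'); last exact: (eval_cat id).
  by move=> l; rewrite mem_cat => /orP[/Yw|/Yw'].
- exists (winv w); last exact: (eval_winv id).
  by move=> l; rewrite mem_rev => /mapP[l' /Yw ? ->].
Qed.

Lemma free_basis_generating_subset X Y : free_basis X -> Y `<=` X ->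
  generated Y = [set: F] -> X = Y.
Proof.
move=> X_basis YX Y_gen; apply/seteqP; split=> // x Xx.
have [w Yw wx] : [set word_value w | w in [set w | word_over Y w]] x.
  have: generated Y x by rewrite Y_gen.
  apply; split=> [|y Yy]; first exact: word_over_subgroup.
  exists [:: (y, false)]; last exact: big_seq1.
  by move=> l; rewrite inE => /eqP ->.
have [u [u_sorted uw u_eval _]] := exists_sorted_noncancelling w.
have Yu : word_over Y u by move=> l /uw /Yw.
suff uE : u = [:: (x, false)] by apply: (Yu (x, false)); rewrite uE mem_head.
apply: (free_basis_uniq X_basis); rewrite ?reducedE //.
- by move=> l /Yu /YX.
- by move=> l; rewrite inE => /eqP ->.
- by rewrite [LHS]word_valueE u_eval -word_valueE wx /word_value big_seq1.
Qed.

Lemma free_basis_finite X : free_basis X -> finitely_generated [set: F] ->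
  exists s : seq F, X = [set` s].
Proof.
move=> X_basis [A A_fin A_gen]; have [sA AE] := (finite_seqP A).1 A_fin.
have /choice[wd wdP] g : exists w, word_over X w /\ word_value w = g.
  by have [w [[Xw _ wE] _]] := X_basis g; exists w.
exists [seq l.1 | l <- flatten [seq wd g | g <- sA]].
apply: (free_basis_generating_subset X_basis) => [_ /mapP[l + ->]|].
  by move=> /flattenP[_ /mapP[g _ ->]]; apply: (wdP g).1.
apply/seteqP; split=> // x _; have: generated A x by rewrite -A_gen.
move=> Ax B [B_sub YB]; apply: Ax; split=> // g; rewrite AE /= => g_in.
rewrite -(wdP g).2 word_valueE; apply: subgroup_eval => // l lg.
apply/YB/mapP; exists l => //.
by apply/flattenP; exists (wd g) => //; apply: map_f.
Qed.

Lemma free_basis_freely_generates (s : seq F) :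
  free_basis [set` s] -> freely_generates (val : seq_sub s -> F).
Proof.
move=> s_basis; pose emb (l : letter (seq_sub s)) : letter F := (val l.1, l.2).
have emb_inj : injective emb by move=> [x b] [y c] [/val_inj -> ->].
have emb_over (w : word (seq_sub s)) : word_over [set` s] (map emb w).
  by move=> l /mapP[l' _ ->]; apply: ssvalP.
have emb_eval (w : word (seq_sub s)) : word_value (map emb w) = eval val w.
  by rewrite /word_value big_map.
have emb_reduced (w : word (seq_sub s)) : sorted noncancelling w -> reduced (map emb w).
  rewrite reducedE sorted_map; apply: sub_sorted => l l'.
  by rewrite /noncancelling /= -[linv (emb l)]/(emb (linv l)) (inj_eq emb_inj).
split=> [g|T m w w' ww' v].
  have [w [[sw _ <-] _]] := s_basis g.
  suff [u uE] : exists u, map emb u = w by exists u; rewrite -emb_eval uE.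
  elim: w sw => [|[x b] w IH] sw; first by exists [::].
  have [l lw|u <-] := IH; first by apply: sw; rewrite inE lw orbT.
  by exists ((SeqSub (sw (x, b) (mem_head _ _)), b) :: u).
have [u [u_sorted _ u_eval <-]] := exists_sorted_noncancelling w.
have [u' [u'_sorted _ u'_eval <-]] := exists_sorted_noncancelling w'.
suff -> : u = u' by [].
apply/(inj_map emb_inj)/(free_basis_uniq s_basis); rewrite ?emb_reduced //.
by rewrite !emb_eval u_eval u'_eval.
Qed.

End FreeBases.

Theorem corollary1p2 (F : groupType)
    (F_free : free_group F)
    (F_fg : finitely_generated [set: F])
    (F_noncyclic : ~ is_cyclic [set: F]) :
  (exists (S : Type) (a : group_action F S),
      [/\ infinite_set [set: S],
          highly_transitive a
        & forall L : set F, is_subgroup L -> finitely_generated L ->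
            infinite_index L -> locally_finite_on a L])
  /\
  (forall (S : Type) (a : group_action F S),
      infinite_set [set: S] ->
      highly_transitive a ->
      (forall L : set F, is_subgroup L -> finitely_generated L ->
         infinite_index L -> locally_finite_on a L) ->
      faithful_action a).
Proof.
have [X X_basis] := F_free; have [s XE] := free_basis_finite X_basis F_fg.
rewrite {}XE in X_basis; have s_free := free_basis_freely_generates X_basis.
have two_letters := two_generators s_free.1 F_noncyclic.
split=> [|S a S_inf a_ht].
  exact: exists_highly_transitive_locally_finite_action s_free two_letters.
exact: faithful_of_locally_finite s_free S_inf (a_ht 1 isT).
Qed.
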